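(* Let $H$ be a Banach space and let the multivalued semiflow $G:\mathbb{R}^+\times H\to P(H)$ be closed. Then there exists a global attractor for $G$ if and only if (i) $G$ has a bounded absorbing set $B_0$ in $H$, i.e. there exists a bounded set $B_0\subset H$ such that for any bounded set $B\subset H$ there exists $t_0>0$ such that $\bigcup_{t\geq t_0}G(t,B)\subset B_0$; and (ii) $G$ is $\omega$-limit compact.
   Context: $\mathbb{R}^+=[0,\infty)$; $P(H)$ is the family of all nonempty subsets of $H$. A map $G:\mathbb{R}^+\times H\to P(H)$ is a multivalued semiflow ($m$-semiflow) if (1) $G(0,z)=\{z\}$ for all $z\in H$, and (2) $G(t+s,z)\subset G(t,G(s,z))$ for all $z\in H$ and $t,s\ge 0$. For $B\subset H$, $G(t,B)=\bigcup_{x\in B}G(t,x)$. $G$ is closed if for all $t\ge 0$ the graph of the multivalued mapping $x\mapsto G(t,x)$ is closed in $H\times H$ with the norm topology on both factors. The Kuratowski measure of noncompactness of a bounded set $A\subset H$ is $\kappa(A)=\inf\{\delta>0: A$ has a finite open cover by sets of diameter $<\delta\}$; for unbounded $A$, $\kappa(A)=\infty$. $G$ is $\omega$-limit compact if for every bounded $B\subset H$, $\kappa\big(\bigcup_{t\ge\tau}G(t,B)\big)\to 0$ as $\tau\to\infty$. For $A,B\subset H$, $\mathrm{dist}_H(A,B)=\sup_{x\in A}\inf_{y\in B}\|x-y\|$. A set $A\subset H$ is a global attractor for $G$ if (1) $A$ is compact in $H$; (2) $A\subset G(t,A)$ for all $t\ge0$; (3) for every bounded $B\subset H$, $\mathrm{dist}_H(G(t,B),A)\to0$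 as $t\to\infty$. *)

(* Defs.v *)
From HB Require Import structures.
From mathcomp Require Import all_boot all_order all_algebra.
From mathcomp Require Import all_classical all_reals all_analysis.

Set Implicit Arguments.
Unset Strict Implicit.
Unset Printing Implicit Defensive.

Import Order.TTheory GRing.Theory Num.Theory.
Import numFieldNormedType.Exports.

Local Open Scope classical_set_scope.
Local Open Scope ring_scope.

Section Definitions.
Context {R : realType} {H : completeNormedModType R}.
Implicit Types (G : R -> H -> set H) (A B : set H).

(* Suprema of sets of nonnegative quantities are taken in [0, +oo], so that
   the supremum of the empty set is 0, whereas [ereal_sup set0 = -oo]. *)
Definition nneg_sup (S : set (\bar R)) : \bar R := ereal_sup (0%E |` S).

Definition diameter A : \bar R :=
  nneg_sup [set d | exists x y, [/\ A x, A y & d = `|x - y|%:E]].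

(* The inner infimum is +oo when [B] is empty. *)
Definition semidist A B : \bar R :=
  nneg_sup [set ereal_inf [set `|x - y|%:E | y in B] | x in A].

Definition has_finite_open_cover A (delta : R) : Prop :=
  exists F : set (set H),
    [/\ finite_set F,
        forall U, F U -> open U /\ (diameter U < delta%:E)%E
      & A `<=` \bigcup_(U in F) U].

Definition kuratowski A : \bar R :=
  if `[< bounded_set A >] then
    ereal_inf [set delta%:E |
      delta in [set delta : R | 0 < delta /\ has_finite_open_cover A delta]]
  else +oo%E.

(* A semiflow on [0, +oo[ is represented by a function on all of [R]; its
   values at negative times are irrelevant. *)
Definition img G (t : R) B : set H := \bigcup_(x in B) G t x.

Definition tail G (tau : R) B : set H :=
  \bigcup_(t in [set t | tau <= t]) img G t B.

Record msemiflow G : Prop := {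
  msemiflow_nonempty : forall t z, 0 <= t -> G t z !=set0 ;
  msemiflow0 : forall z, G 0 z = [set z] ;
  msemiflowD : forall t s z, 0 <= t -> 0 <= s ->
    G (t + s) z `<=` img G t (G s z) }.

Definition closed_semiflow G : Prop :=
  forall t, 0 <= t -> closed [set p : H * H | G t p.1 p.2].

Definition omega_limit_compact G : Prop :=
  forall B, bounded_set B ->
    kuratowski (tail G tau B) @[tau --> +oo] --> 0%E.

Definition absorbing G (B0 : set H) : Prop :=
  forall B, bounded_set B -> exists2 t0 : R, 0 < t0 & tail G t0 B `<=` B0.

Record global_attractor G A : Prop := {
  attractor_compact : compact A ;
  attractor_sub : forall t, 0 <= t -> A `<=` img G t A ;
  attractor_attracts : forall B, bounded_set B ->
    semidist (img G t B) A @[t --> +oo] --> 0%E }.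

End Definitions.

(* Main.v *)
Require Import Defs.
From HB Require Import structures.
From mathcomp Require Import all_boot all_order all_algebra.
From mathcomp Require Import all_classical all_reals all_analysis.
From mathcomp Require Import finmap ring lra.

Import Order.TTheory GRing.Theory Num.Theory.
Import numFieldNormedType.Exports.

Local Open Scope classical_set_scope.
Local Open Scope ring_scope.

(** The attractor, when conditions (i) and (ii) hold, is the omega-limit set of
    the bounded absorbing set [B0], that is, the intersection of the closures
    of the tails of [B0]. The compactness behind everything is Kuratowski's:
    since the measure of noncompactness of the tails tends to 0, an ultrafilter
    containing all the tails contains sets of arbitrarily small diameter, so it
    is Cauchy and converges, necessarily to a point of the omega-limit set.
    Hence any decreasing family of nonempty parts of the tails accumulates at
    a point of the omega-limit set ([omega_limit_cluster]); the same argument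
    applied to an ultrafilter on the omega-limit set shows that this set is
    compact ([omega_limit_is_compact]).

    Both remaining properties follow from [omega_limit_cluster]. If [y] is in
    the omega-limit set, consider the points of late tails which [G t] sends
    close to [y]; they exist because [G (t + s) x] is included in
    [G t (G s x)], and at an accumulation point [z] the closedness of the graph
    of [G t] gives [G t z y] ([omega_limit_sub]). If a bounded set [B] were not
    attracted, the points of its late tails staying away from the omega-limit
    set would accumulate at a point of that very set; here late tails of [B]
    are compared with tails of [B0] through absorption
    ([omega_limit_attracts]).

    Conversely, every tail of a bounded set, taken late enough, lies in an
    arbitrarily small neighbourhood of the compact attractor. A fixed
    neighbourhood is contained in a bounded absorbing ball, and a finite cover
    of the attractor by small balls becomes, on doubling the radii, a finite
    cover of the tail by small open sets. *)

(** * Nonnegative suprema and convergence to zero *)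

Section ExtendedReals.
Set Implicit Arguments. Unset Strict Implicit.
Context {R : realType}.

Lemma nneg_sup_ge0 (S : set (\bar R)) : (0 <= nneg_sup S)%E.
Proof. by apply: ereal_sup_ubound; left. Qed.

Lemma le_nneg_sup (S : set (\bar R)) x : S x -> (x <= nneg_sup S)%E.
Proof. by move=> Sx; apply: ereal_sup_ubound; right. Qed.

Lemma nneg_sup_le (S : set (\bar R)) e :
  (0 <= e)%E -> (forall x, S x -> (x <= e)%E) -> (nneg_sup S <= e)%E.
Proof. by move=> e0 Se; apply: ge_ereal_sup => x [->//|]; exact: Se. Qed.

Lemma nneg_cvge0P (T : Type) (F : set_system T) (FF : Filter F)
    (f : T -> \bar R) : (forall x, (0 <= f x)%E) ->
  f x @[x --> F] --> 0%E <->
  forall e : R, 0 < e -> \forall x \near F, (f x < e%:E)%E.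
Proof.
move=> f0; split=> [f_0 e e0|fe].
  by apply: (f_0 [set y | (y < e%:E)%E]); apply: open_ereal_lt'; rewrite lte_fin.
apply/fine_cvgP; split.
  near=> x; rewrite ge0_fin_numE// (@lt_trans _ _ 1%:E) ?ltry//.
  by near: x; exact: fe.
apply/cvgrPdist_lt => e e0; near=> x.
have fxe : (f x < e%:E)%E by near: x; exact: fe.
rewrite sub0r normrN /= ger0_norm ?fine_ge0//.
by rewrite -lte_fin fineK// ge0_fin_numE// (lt_trans fxe)// ltry.
Unshelve. all: by end_near. Qed.

End ExtendedReals.

(** * Finite covers by small sets *)

Section SmallCovers.
Set Implicit Arguments. Unset Strict Implicit.
Context {R : realType} {H : completeNormedModType R}.
Implicit Types (A B : set H).

Lemma closure_normP A x :
  closure A x <-> forall e, 0 < e -> exists2 y, A y & `|x - y| < e.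
Proof.
split=> [Ax e e0|Ax B /nbhs_ballP[e /= e0 eB]].
  have [y [Ay]] := Ax _ (nbhsx_ballx x e e0).
  by rewrite -ball_normE => ?; exists y.
have [y Ay xy] := Ax e e0; exists y; split=> //.
by apply: eB; rewrite -ball_normE.
Qed.

(** [A] is covered by finitely many sets, not necessarily open, in each of
    which any two points are at distance at most [e]. *)
Definition small_cover A (e : R) : Prop :=
  exists F : set (set H), [/\ finite_set F,
    forall U x y, F U -> U x -> U y -> `|x - y| <= e &
    A `<=` \bigcup_(U in F) U].

Lemma kuratowski_ge0 A : (0 <= kuratowski A)%E.
Proof.
rewrite /kuratowski; case: asboolP => // _.
by apply: le_ereal_inf_tmp => _ [d [d0 _] <-]; rewrite lee_fin ltW.
Qed.

Lemma kuratowski_small_cover A e :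
  (kuratowski A < e%:E)%E -> small_cover A e.
Proof.
rewrite /kuratowski; case: asboolP => // _ /ereal_inf_lt.
move=> [_ [d [_ [F [finF F_d AF]]] <-]]; rewrite lte_fin => de.
exists F; split=> // U x y FU Ux Uy.
have [_ dU] := F_d _ FU; apply/(le_trans _ (ltW de)); rewrite -lee_fin.
by apply/(le_trans _ (ltW dU))/le_nneg_sup; exists x, y.
Qed.

Lemma small_cover_closure A e :
  0 < e -> small_cover A e -> small_cover (closure A) (3 * e).
Proof.
move=> e0 [F [finF Fe AF]].
(* Thickening every piece by [e] increases its diameter by at most [2 * e]. *)
pose thick (U : set H) := [set x | exists2 y, U y & `|x - y| <= e].
exists (thick @` F); split; first exact: finite_image.
  move=> _ x y [U FU <-] [x' Ux' xx'] [y' Uy' yy'].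
  have -> : x - y = (x - x') + (x' - y') - (y - y').
    by rewrite addrA subrK opprB addrA subrK.
  rewrite (le_trans (ler_normB _ _))//.
  have := ler_normD (x - x') (x' - y'); have := Fe _ _ _ FU Ux' Uy'; lra.
move=> x /closure_normP/(_ e e0)[y /AF[U FU Uy] xy].
by exists (thick U); [exists U|exists y => //; exact: ltW].
Qed.

Lemma ultra_bigcup (T : Type) (I : choiceType) (U : set_system T)
    (D : set I) (f : I -> set T) : UltraFilter U -> finite_set D ->
  U (\bigcup_(i in D) f i) -> exists2 i, D i & U (f i).
Proof.
move=> UU /finite_fsetP[X ->] UD; apply: contrapT => noU.
have : U (\bigcap_(i in [set` X]) ~` f i).
  apply: filter_bigI => i iX.
  by have [Ufi|//] := in_ultra_setVsetC (f i) UU; case: noU; exists i.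
move=> /(filterI UD) /filter_ex[x [[i iX fx]]] /(_ i iX); exact.
Qed.

(** An ultrafilter containing sets with finite covers by arbitrarily small
    pieces contains arbitrarily small pieces, hence is Cauchy. *)
Lemma small_cover_ultra_cvg (U : set_system H) : UltraFilter U ->
  (forall e, 0 < e -> exists2 C, U C & small_cover C e) ->
  exists z : H, U --> z.
Proof.
move=> UU Usmall; apply/cvg_ex; apply: (@cauchy_cvg H).
apply: (@cauchy_exP R H) => e /= e0.
have [|C UC [F [finF Fe CF]]] := Usmall (e / 2); first lra.
have [V FV UV] := ultra_bigcup UU finF (filterS CF UC).
have [x Vx] := filter_ex UV; exists x.
apply: filterS UV => y Vy; rewrite -ball_normE /=.
by have := Fe _ _ _ FV Vx Vy; lra.
Qed.

End SmallCovers.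

(** * Semidistance to a set *)

Section Semidistance.
Set Implicit Arguments. Unset Strict Implicit.
Context {R : realType} {H : completeNormedModType R}.
Implicit Types (A B : set H).

Lemma semidist_ge0 A B : (0 <= semidist A B)%E.
Proof. exact: nneg_sup_ge0. Qed.

Lemma semidist_lt A B e : (semidist A B < e%:E)%E ->
  forall x, A x -> exists2 y, B y & `|x - y| < e.
Proof.
move=> ABe x Ax.
have : (ereal_inf [set `|x - y|%:E | y in B] < e%:E)%E.
  by apply: le_lt_trans ABe; apply: le_nneg_sup; exists x.
by move=> /ereal_inf_lt[_ [y By <-]]; rewrite lte_fin => ?; exists y.
Qed.

Lemma semidist_le A B e : 0 <= e ->
  (forall x, A x -> exists2 y, B y & `|x - y| < e) ->
  (semidist A B <= e%:E)%E.
Proof.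
move=> e0 ABe; apply: nneg_sup_le => [|_ [x Ax <-]]; first by rewrite lee_fin.
have [y By xy] := ABe x Ax.
have xye : (`|x - y|%:E <= e%:E)%E by rewrite lee_fin ltW.
by apply: le_trans xye; apply: ereal_inf_lbound; exists y.
Qed.

End Semidistance.

(** * Tails of a semiflow and limit sets *)

Section Semiflow.
Set Implicit Arguments. Unset Strict Implicit.
Context {R : realType} {H : completeNormedModType R}.
Implicit Types (G : R -> H -> set H) (A B : set H).

Lemma bounded_norm A : bounded_set A -> exists M, forall x, A x -> `|x| <= M.
Proof.
have [->|/set0P A0] := eqVneq A set0; first by exists 0.
have PA : ProperFilter (globally A).
  by case: A0 => a Aa; exact: globally_properfilter Aa.
move=> Ab; have [M AM] := (@ex_bound _ _ _ (fun x : H => x) _ PA).1 Ab.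
by exists M.
Qed.

Lemma norm_bounded A M : (forall x, A x -> `|x| <= M) -> bounded_set A.
Proof.
move=> AM; rewrite /= /bounded_near; near=> N => x /AM xM.
by rewrite /= (le_trans xM).
Unshelve. all: by end_near. Qed.

Lemma tail_homo G B s t : s <= t -> tail G t B `<=` tail G s B.
Proof. by move=> st x [r /= tr Bx]; exists r => //=; exact: le_trans tr. Qed.

(** If [B'] absorbs [B] from time [T] on, then up to a delay [T] the tails of
    [B] are contained in those of [B']. *)
Lemma tail_shift G B B' T tau : msemiflow G -> 0 <= T -> 0 <= tau ->
  tail G T B `<=` B' -> tail G (tau + T) B `<=` tail G tau B'.
Proof.
move=> Gf T0 tau0 TB' y [t /= tT [x Bx]].
have -> : t = (t - T) + T by rewrite subrK.
have tT0 : tau <= t - T by lra.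
move=> /(msemiflowD Gf (le_trans tau0 tT0) T0)[z Gz Gy].
exists (t - T) => //; exists z => //; apply: TB'.
by exists T => //=; exists x.
Qed.

(** The omega-limit set of [B]. As the tails decrease with [tau], intersecting
    over all of [R] is the same as intersecting over large times. *)
Definition omega_limit G B : set H :=
  \bigcap_(tau in [set: R]) closure (tail G tau B).

Lemma tail_small_cover G B e : omega_limit_compact G -> bounded_set B ->
  0 < e -> exists tau, small_cover (tail G tau B) e.
Proof.
move=> Gc Bb e0; have /nneg_cvge0P := Gc B Bb.
move=> /(_ (fun=> kuratowski_ge0 _) e e0) /filter_ex[tau kt].
by exists tau; exact: kuratowski_small_cover.
Qed.

Lemma omega_limit_is_compact G B : omega_limit_compact G -> bounded_set B ->
  compact (omega_limit G B).
Proof.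
move=> Gc Bb; rewrite compact_ultra => U UU UA.
have [|z Uz] := small_cover_ultra_cvg UU.
  move=> e e0; have e3 : 0 < e / 3 by lra.
  have [tau St] := tail_small_cover Gc Bb e3.
  exists (closure (tail G tau B)); first by apply: filterS UA => x; apply.
  have -> : e = 3 * (e / 3) by field.
  exact: small_cover_closure.
exists z; split=> // tau _.
apply: (@closed_closure _ (tail G tau B)) => V /Uz UV.
have [y [Ay Vy]] := filter_ex (filterI UA UV).
by exists y; split=> //; exact: Ay.
Qed.

(** A decreasing family of nonempty parts of the tails accumulates at a point
    of the limit set: an ultrafilter containing all of them converges. *)
Lemma omega_limit_cluster G B (S : R -> set H) :
  omega_limit_compact G -> bounded_set B ->
  (forall s t, s <= t -> S t `<=` S s) -> (forall t, S t !=set0) ->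
  (forall t, S t `<=` tail G t B) ->
  exists2 z, omega_limit G B z & forall t, closure (S t) z.
Proof.
move=> Gc Bb Sle S0 SG.
pose F := filter_from [set: R] S.
have FF : ProperFilter F.
  apply: filter_from_proper => //; apply: filter_from_filter.
    by exists 0.
  move=> s t _ _; exists (Num.max s t) => // x Sx.
  by split; apply: Sle Sx; rewrite le_max lexx ?orbT.
have [U [UU FU]] := ultraFilterLemma FF.
have US t : U (S t) by apply: FU; exists t.
have [|z Uz] := small_cover_ultra_cvg UU.
  move=> e e0; have [tau St] := tail_small_cover Gc Bb e0.
  by exists (tail G tau B) => //; apply: filterS (US tau); exact: SG.
have clS t : closure (S t) z.
  move=> V /Uz UV; exact: filter_ex (filterI (US t) UV).
by exists z => // t _; apply: closureS (clS t); exact: SG.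
Qed.

(** * The limit set of a bounded absorbing set is an attractor *)

(** The omega-limit set is negatively semi-invariant. *)
Lemma omega_limit_sub G B t : msemiflow G -> closed_semiflow G ->
  omega_limit_compact G -> bounded_set B -> 0 <= t ->
  omega_limit G B `<=` img G t (omega_limit G B).
Proof.
move=> Gf Gcl Gc Bb t0 y Ay.
(* Points of the tail sent by [G t] to within [1 / s] of [y]; the bound is
   written as a product so that it is monotone in [s] over all of [R]. *)
pose S s := [set z | tail G s B z /\ exists2 w, G t z w & `|y - w| * s < 1].
have [||| z Az Sz] := omega_limit_cluster Gc Bb (S := S).
- move=> r s rs z [zs [w Gw yw]]; split; first exact: tail_homo zs.
  by exists w => //; apply: le_lt_trans yw; rewrite ler_wpM2l.
- move=> s; have m0 : 0 < Num.max s 1 by rewrite lt_max ltr01 orbT.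
  have sm : s <= Num.max s 1 by rewrite le_max lexx.
  have /closure_normP/(_ (Num.max s 1)^-1) := Ay (Num.max s 1 + t) I.
  rewrite invr_gt0 => /(_ m0)[w [r /= sr [x Bx]]].
  have -> : r = t + (r - t) by rewrite addrC subrK.
  have rt : Num.max s 1 <= r - t by lra.
  move=> /(msemiflowD Gf t0 (le_trans (ltW m0) rt))[z Gz Gw] yw.
  exists z; split; first by exists (r - t); [exact: le_trans rt|exists x].
  exists w => //; apply: (@le_lt_trans _ _ (`|y - w| * Num.max s 1)).
    by rewrite ler_wpM2l.
  by rewrite -ltr_pdivlMr// div1r.
- by move=> s z [].
exists z => //; have : closed [set p : H * H | G t p.1 p.2] by exact: Gcl.
move=> /(_ (z, y)); apply=> V /nbhs_ballP[e /= e0 eV].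
have e1 : 0 < e^-1 by rewrite invr_gt0.
have /closure_normP/(_ e e0)[z' [_ [w Gw yw]] zz'] := Sz e^-1.
exists (z', w); split=> //; apply: eV; split=> /=; rewrite -ball_normE //=.
by move: yw; rewrite ltr_pdivrMr// mul1r.
Qed.

Lemma omega_limit_attracts G B0 B : msemiflow G -> omega_limit_compact G ->
  bounded_set B0 -> absorbing G B0 -> bounded_set B ->
  semidist (img G t B) (omega_limit G B0) @[t --> +oo] --> 0%E.
Proof.
move=> Gf Gc B0b B0a Bb.
apply/nneg_cvge0P => [t|e e0]; first exact: semidist_ge0.
have [T T0 TB] := B0a B Bb.
(* Unattracted points of late tails would be [far], and would accumulate at a
   point of the omega-limit set. *)
pose far := [set y | forall a, omega_limit G B0 a -> e / 2 <= `|y - a|].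
suff [s sfar] : exists s, tail G s B `&` far = set0.
  near=> t; apply: (@le_lt_trans _ _ (e / 2)%:E); last by rewrite lte_fin; lra.
  apply: semidist_le => [|y Gy]; first lra.
  apply: contrapT => nfar; suff : (tail G s B `&` far) y by rewrite sfar.
  split; first by exists t => //=; near: t; exact/nbhs_pinfty_ge/num_real.
  move=> a Aa; rewrite leNgt; apply/negP => ya.
  by apply: nfar; exists a.
apply: contrapT => nfar.
pose S s := tail G (Num.max s 0 + T) B `&` far.
have [||| z Az Sz] := omega_limit_cluster Gc B0b (S := S).
- move=> r s rs y [ys yf]; split=> //; apply: tail_homo ys.
  by rewrite lerD2r ge_max !le_max rs lexx orbT.
- move=> s; apply/set0P/eqP => S0; apply: nfar.
  by exists (Num.max s 0 + T).
- move=> s y [ys _]; apply: (@tail_homo _ _ s (Num.max s 0)).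
    by rewrite le_max lexx.
  by apply: tail_shift ys => //; [exact: ltW|rewrite le_max lexx orbT].
have e2 : 0 < e / 2 by lra.
have /closure_normP/(_ _ e2)[y [_ /(_ z Az)]] := Sz 0.
by rewrite distrC; lra.
Unshelve. all: by end_near. Qed.

(** * Consequences of the existence of an attractor *)

(** Late tails of a bounded set lie in any given neighbourhood of the
    attractor. *)
Lemma attractor_tail G A B e : global_attractor G A -> bounded_set B -> 0 < e ->
  exists2 t0, 0 < t0 & forall y, tail G t0 B y -> exists2 a, A a & `|y - a| < e.
Proof.
move=> GA Bb e0.
have /nneg_cvge0P := attractor_attracts GA Bb.
move=> /(_ (fun=> semidist_ge0 _ _) e e0)[M [_ Me]].
exists (Num.max M 0 + 1); first by rewrite ltr_wpDl// le_max lexx orbT.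
move=> y [t /= Mt ty]; apply: semidist_lt ty; apply: Me.
by apply: lt_le_trans Mt; rewrite ltr_pwDr// le_max lexx.
Qed.

Lemma attractor_absorbing G A : global_attractor G A ->
  exists B0, bounded_set B0 /\ absorbing G B0.
Proof.
move=> GA; have [M AM] := bounded_norm (compact_bounded (attractor_compact GA)).
exists [set x | `|x| <= M + 1]; split; first exact: (@norm_bounded _ (M + 1)).
move=> B Bb; have [t0 t00 tA] := attractor_tail GA Bb ltr01.
exists t0 => // y /tA[a /AM aM ya] /=.
rewrite -[y](subrK a) (le_trans (ler_normD _ _))//; lra.
Qed.

Lemma compact_finite_balls A e : compact A -> 0 < e ->
  exists2 D : set H, finite_set D & A `<=` \bigcup_(c in D) ball c e.
Proof.
rewrite compact_cover => Ac e0.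
have [||D _ AD] := Ac H A (fun c => ball c e).
- by move=> c _; exact: ball_open.
- by move=> a Aa; exists a => //; exact: ballxx.
by exists [set` D].
Qed.

Lemma attractor_omega_limit_compact G A :
  global_attractor G A -> omega_limit_compact G.
Proof.
move=> GA B Bb; apply/nneg_cvge0P => [t|e e0]; first exact: kuratowski_ge0.
have [B0 [B0b B0a]] := attractor_absorbing GA.
have [T _ TB0] := B0a B Bb.
(* The tail is covered by balls of radius [2 * (e / 6)], whose diameter is at
   most [4 * (e / 6)], so its measure of noncompactness is at most
   [5 * (e / 6) < e]. *)
have e6 : 0 < e / 6 by lra.
have [D finD AD] := compact_finite_balls (attractor_compact GA) e6.
have [t0 _ tA] := attractor_tail GA Bb e6.
near=> t.
have Tt : T <= t by near: t; exact/nbhs_pinfty_ge/num_real.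
have t0t : t0 <= t by near: t; exact/nbhs_pinfty_ge/num_real.
rewrite /kuratowski; case: asboolP => [_|] /=; last first.
  case; have [M B0M] := bounded_norm B0b; apply: (@norm_bounded _ M) => x xt.
  apply: B0M; apply: TB0; exact: tail_homo xt.
apply/ereal_inf_ltP; exists (5 * (e / 6))%:E; last by rewrite lte_fin; lra.
exists (5 * (e / 6)) => //; split; first lra.
exists ((fun c => ball c (2 * (e / 6))) @` D); split.
- exact: finite_image.
- move=> _ [c Dc <-]; split; first exact: ball_open.
  apply: (@le_lt_trans _ _ (4 * (e / 6))%:E); last by rewrite lte_fin; lra.
  apply: nneg_sup_le => [|_ [x [y [cx cy ->]]]]; first by rewrite lee_fin; lra.
  move: cx cy; rewrite -ball_normE /= lee_fin => cx cy.
  by have := ler_distD c x y; rewrite (distrC x c); lra.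
- move=> y yt; have [|a /AD[c Dc ca] ya] := tA y.
    exact: tail_homo yt.
  exists (ball c (2 * (e / 6))); first by exists c.
  move: ca; rewrite -ball_normE /= => ca.
  by have := ler_distD a c y; rewrite (distrC a y); lra.
Unshelve. all: by end_near. Qed.

End Semiflow.

Theorem theorem2p1 (R : realType) (H : completeNormedModType R)
    (G : R -> H -> set H) (Gflow : msemiflow G) (Gclosed : closed_semiflow G) :
  (exists A : set H, global_attractor G A) <->
  (exists B0 : set H, bounded_set B0 /\ absorbing G B0) /\
  omega_limit_compact G.
Proof.
split=> [[A GA]|[[B0 [B0b B0a]] Gc]].
  split; first exact: attractor_absorbing GA.
  exact: attractor_omega_limit_compact GA.
exists (omega_limit G B0); split.
- exact: omega_limit_is_compact.
- by move=> t t0; exact: omega_limit_sub.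
- by move=> B; exact: omega_limit_attracts.
Qed.
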